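(* Let $n \ge 3$ and $0 \le k \le n-3$ be integers, and let $P_{\min_{n,k}} = \{p_1,\dots,p_n\}$ be the sequence with $p_1 = 1$; $p_i = F(i-1)$ for $2 \le i \le k+2$; $p_{k+3} = F(k+2) = w_{F(k+2),0}$; and $p_i = w_{F(k+2),\, i-k-3}$ for $k+4 \le i \le n$ (the minimizing $k$-ordered sequence of the elongated binary tree in class $M_{n,k}$). Let $T$ be the elongated binary tree of size $n$ that is the Huffman tree of $P_{\min_{n,k}}$. Then $$E(T, P_{\min_{n,k}}) = F(n+3) + F(n-k+1) - (n-k+3).$$
   Context: $F(i)$ denotes the $i$-th Fibonacci number: $F(0)=0$, $F(1)=1$, $F(i)=F(i-1)+F(i-2)$ for $i>1$. Let $\varphi=(1+\sqrt5)/2$. The (generalized) Wythoff array $(w_{i,j})_{i\ge0,j\ge0}$ is defined by $w_{i,0}=i$, $w_{i,1}=\lfloor (i+1)\varphi\rfloor$, and $w_{i,j}=w_{i,j-1}+w_{i,j-2}$ for $j\ge2$. A (strictly) binary tree is an ordered rooted tree in which every non-leaf node has exactly two children; its size is its number of leaves. A binary tree is elongated if among any two sibling nodes at least one is a leaf. For a binary tree $T$ with positive weights $p_1,\dots,p_n$ at its leaves, the weighted external path length is $E(T,P)=\sum_{i=1}^n l_i p_i$, where $l_i$ is the length of the path from the root to leaf $i$. Huffman algorithm on a non-decreasing sequence $P$ of positive integers repeatedly replaces the two smallest weights by their sum (re-sorting each time) until one weight remains; the merges define a Huffman tree of $P$, which minimizes $E(T,P)$ over binary trees with leaf weights $P$.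 A non-decreasing sequence $P$ of $n$ positive integers with intermediate sequences $P^{(i)}=\{p^{(i)}_1,\dots\}$ ($P^{(0)}=P$, $P^{(i)}$ the sequence after the $i$-th merge) is $k$-ordered if $p^{(i)}_2 = p^{(i)}_3$ for $i=0,\dots,k$ and $p^{(i)}_2 < p^{(i)}_3$ for $i=k+1,\dots,n-3$; $M_{n,k}$ is the set of $k$-ordered sequences of size $n$ whose Huffman tree is elongated. *)

(* Defs.v *)
From HB Require Import structures.
From mathcomp Require Import all_boot all_order all_algebra.
From mathcomp Require Import reals.

Set Implicit Arguments.
Unset Strict Implicit.
Unset Printing Implicit Defensive.

Fixpoint fib (n : nat) : nat :=
  match n with
  | 0 => 0
  | m.+1 => match m with
            | 0 => 1
            | l.+1 => fib m + fib l
            end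
  end.

Definition golden_ratio (R : realType) : R := ((1 + Num.sqrt 5%:R) / 2%:R)%R.

(* The argument of floor is nonnegative, so absz only casts from int to nat. *)
Fixpoint wythoff (R : realType) (i j : nat) : nat :=
  match j with
  | 0 => i
  | j'.+1 => match j' with
             | 0 => `|Num.floor (i.+1%:R * golden_ratio R)%R|%N
             | j''.+1 => wythoff R i j' + wythoff R i j''
             end
  end.

(* Strictly binary ordered trees whose leaves carry their weights. *)
Inductive btree : Type :=
| Leaf of nat
| Node of btree & btree.

Lemma btree_comparable : comparable btree.
Proof. by rewrite /comparable /decidable; do 2!decide equality. Defined.

HB.instance Definition _ := comparableMixin btree_comparable.

(* The pairs (l, p), from left to right, where p is the weight of a leaf of t
   and l is d plus the length of the path from the root of t to that leaf. *)
Fixpoint leaves_from (d : nat) (t : btree) : seq (nat * nat) :=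
  match t with
  | Leaf p => [:: (d, p)]
  | Node l r => leaves_from d.+1 l ++ leaves_from d.+1 r
  end.

Definition leaves (t : btree) : seq (nat * nat) := leaves_from 0 t.

Definition tree_size (t : btree) : nat := size (leaves t).

(* E(T, P), where P is the family of the leaf weights of T. *)
Definition ext_path_length (t : btree) : nat :=
  \sum_(x <- leaves t) x.1 * x.2.

Definition is_leaf (t : btree) : bool := if t is Leaf _ then true else false.

Fixpoint elongated (t : btree) : bool :=
  match t with
  | Leaf _ => true
  | Node l r => [&& is_leaf l || is_leaf r, elongated l & elongated r]
  end.

Fixpoint weight (t : btree) : nat :=
  match t with
  | Leaf p => p
  | Node l r => weight l + weight r
  end.

(* huffman_run f T: the Huffman algorithm, started on the forest f, can end with
   the tree T. Each step joins two trees of smallest weight. All resolutions of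
   ties between equal weights and both left-right orders are allowed. *)
Inductive huffman_run : seq btree -> btree -> Prop :=
| HuffmanStop T : huffman_run [:: T] T
| HuffmanMerge f g t1 t2 T :
    perm_eq f [:: t1, t2 & g] ->
    all (fun t => (weight t1 <= weight t) && (weight t2 <= weight t)) g ->
    huffman_run (Node t1 t2 :: g) T ->
    huffman_run f T.

Definition huffman_tree (P : seq nat) (T : btree) : Prop :=
  huffman_run (map Leaf P) T.

(* The i-th term p_i, for 1 <= i <= n. The last branch includes
   p_(k+3) = w_(F(k+2),0) = F(k+2). *)
Definition pmin_term (R : realType) (k i : nat) : nat :=
  if i == 1 then 1
  else if i <= k + 2 then fib (i - 1)
  else wythoff R (fib (k + 2)) (i - (k + 3)).

Definition pmin (R : realType) (n k : nat) : seq nat :=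
  [seq pmin_term R k i | i <- iota 1 n].

(* Main.v *)
(** Joining two trees adds their weights to the external path length, so [E(T, P)]
    is the sum of the weights of all merged trees, and this sum does not depend
    on how ties are resolved. Since [floor ((F(m) + 1) phi) = F(m+1) + 1] for
    [m >= 2], the terms of the sequence are [p_i = F(i-1) + F(i-k-3)] for [i >= 2],
    with [F] read as [0] at negative arguments. Hence
    [p_1 + ... + p_i = F(i+1) + F(i-k-1) - 1 <= p_(i+2)] (without the last two
    terms when [i < k+3]), so every merge joins the tree of the first [i] leaves
    with the leaf [p_(i+1)], and the partial sums telescope. *)
Require Import Defs.
From mathcomp Require Import all_boot all_order all_algebra.
From mathcomp Require Import reals.
From mathcomp Require Import zify ring lra.

Set Implicit Arguments.
Unset Strict Implicit.
Unset Printing Implicit Defensive.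

Import Order.TTheory GRing.Theory Num.Theory.

Lemma fibSS m : fib m.+2 = fib m.+1 + fib m.
Proof. by []. Qed.

Lemma fib_leq : {homo fib : m n / m <= n}.
Proof.
apply: homo_leq => // [m n p|[|m]]; [exact: leq_trans | by [] |].
by rewrite fibSS leq_addr.
Qed.

Lemma fib_gt0 m : 0 < fib m.+1.
Proof. exact: (@fib_leq 1). Qed.

Section GoldenRatio.
Local Open Scope ring_scope.
Variable R : realType.
Local Notation phi := (golden_ratio R).

Lemma golden_ratio_sq : phi * phi = phi + 1.
Proof.
have := @sqr_sqrtr R 5%:R (ler0n _ _).
by rewrite /golden_ratio; move: (Num.sqrt _) => s hs; field: hs.
Qed.

Lemma golden_ratio_bounds : 161%:R / 100%:R <= phi <= 162%:R / 100%:R.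
Proof.
have h0 : 0 <= phi.
  by rewrite /golden_ratio divr_ge0 // addr_ge0 // sqrtr_ge0.
by have h := golden_ratio_sq; apply/andP; split; nra.
Qed.

(** The interval contains the initial error [phi - 2], is mapped into itself by the factor
    [1 - phi], and lands inside [[1, 2)] when [phi] is added, as the floor computation requires. *)
Lemma fib_golden_ratio_bounds m :
  - (39%:R / 100%:R) <= (fib m.+2)%:R * phi - (fib m.+3)%:R <= 1 / 4%:R.
Proof.
have /andP[h1 h2] := golden_ratio_bounds.
elim: m => [|m /andP[h3 h4]]; first by rewrite /=; apply/andP; split; lra.
(* The errors [F(m) phi - F(m+1)] form a geometric sequence of ratio
   [- 1 / phi = 1 - phi]. *)
have -> : (fib m.+3)%:R * phi - (fib m.+4)%:R
        = (1 - phi) * ((fib m.+2)%:R * phi - (fib m.+3)%:R).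
  by rewrite (fibSS m.+2) natrD; ring: golden_ratio_sq.
by apply/andP; split; nra.
Qed.

Lemma floor_fibS_golden_ratio m :
  Num.floor ((fib m.+2).+1%:R * phi) = (fib m.+3).+1.
Proof.
have /andP[h1 h2] := golden_ratio_bounds.
have /andP[h3 h4] := fib_golden_ratio_bounds m.
apply: floor_def; rewrite -[(fib m.+2).+1]addn1 natrD mulrDl mul1r.
rewrite intrD -pmulrn -[(fib m.+3).+1]addn1 natrD.
by apply/andP; split; lra.
Qed.

End GoldenRatio.

(** Both sides obey the Fibonacci recurrence in [j], so the induction carries two consecutive
    columns. *)
Lemma wythoff_fib (R : realType) m j :
  wythoff R (fib m.+2) j = fib (j + m.+2) + fib j.
Proof.
have [] // : wythoff R (fib m.+2) j = fib (j + m.+2) + fib j /\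
  wythoff R (fib m.+2) j.+1 = fib (j.+1 + m.+2) + fib j.+1.
elim: j => [|j [IH1 IH2]]; split=> //; first by rewrite addn0.
  by rewrite [LHS]/= floor_fibS_golden_ratio absz_nat addn1.
rewrite -[LHS]/(wythoff R (fib m.+2) j.+1 + wythoff R (fib m.+2) j) IH1 IH2.
by rewrite !addSn !fibSS addnACA.
Qed.

Lemma pmin_termSS (R : realType) k j :
  pmin_term R k j.+2 = fib j.+1 + fib (j.+1 - k.+2).
Proof.
rewrite /pmin_term (_ : (j.+2 == 1) = false) // subn1 !addn2 addn3 !subSS.
case: ltnP => hj; first by rewrite (_ : j - k.+1 = 0) ?addn0 //; lia.
by rewrite wythoff_fib; congr (fib _ + _); lia.
Qed.

(** Sorting puts the two smallest weights first, so ties affect neither their sum nor the multiset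
    of the remaining weights. *)
Lemma perm_two_smallest (a b c d : nat) (g h : seq nat) :
  perm_eq [:: a, b & g] [:: c, d & h] ->
  all (fun z => (a <= z) && (b <= z)) g ->
  all (fun z => (c <= z) && (d <= z)) h ->
  a + b = c + d /\ perm_eq g h.
Proof.
have sorted_split (x y : nat) s : all (fun z => (x <= z) && (y <= z)) s ->
    sort leq [:: x, y & s] = sort leq [:: x; y] ++ sort leq s.
  move=> hs; apply: (sorted_eq leq_trans anti_leq).
  - exact: sort_sorted leq_total _.
  - rewrite (sorted_pairwise leq_trans) pairwise_cat -!(sorted_pairwise leq_trans).
    rewrite !(sort_sorted leq_total) !andbT.
    apply/allrelP => u v; rewrite !mem_sort !inE => hu hv.
    by have /andP[hx hy] := allP hs v hv; case/orP: hu => /eqP->.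
  - rewrite perm_sort -[_ :: _]/([:: x; y] ++ s) perm_sym.
    by apply: perm_cat; rewrite perm_sort.
move=> hp hg hh; have := perm_sortP leq_total leq_trans anti_leq _ _ hp.
rewrite (sorted_split a b) // (sorted_split c d) // => /eqP; rewrite eqseq_cat ?size_sort // => /andP[].
move=> /eqP/(perm_sortP leq_total leq_trans anti_leq) hab.
move=> /eqP/(perm_sortP leq_total leq_trans anti_leq) ->; split=> //.
by have := perm_sumn hab; rewrite /= !addn0.
Qed.

(* [x] is the weight of the tree built so far and [s] lists the weights of the
   leaves that will be joined to it, in this order. *)
Fixpoint chain_cost (x : nat) (s : seq nat) : nat :=
  if s is y :: s' then (x + y) + chain_cost (x + y) s' else 0.

Fixpoint chain_smallest (x : nat) (s : seq nat) : bool :=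
  if s is y :: s' then
    all (fun z => (x <= z) && (y <= z)) s' && chain_smallest (x + y) s'
  else true.

Lemma sum_leaves_from d t :
  \sum_(x <- leaves_from d t) x.1 * x.2 = ext_path_length t + d * weight t.
Proof.
rewrite /ext_path_length /leaves; elim: t d => [p|l IHl r IHr] d /=.
  by rewrite !big_seq1 /= mul0n.
by rewrite !big_cat /= !(IHl d.+1) !(IHr d.+1) (IHl 1) (IHr 1); lia.
Qed.

Lemma ext_path_length_Node l r :
  ext_path_length (Node l r)
  = ext_path_length l + ext_path_length r + (weight l + weight r).
Proof.
by rewrite {1}/ext_path_length /leaves /= big_cat /= !sum_leaves_from; lia.
Qed.

(** Induction on the run. Only the multiset of weights is tracked: however ties are resolved, a
    merge costs [x + y] and leaves the same weights as the chain. *)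
Lemma huffman_run_chain f T x s :
  huffman_run f T -> perm_eq (map weight f) (x :: s) -> chain_smallest x s ->
  ext_path_length T = \sum_(t <- f) ext_path_length t + chain_cost x s.
Proof.
move=> run; elim: run x s => {f T} [T|f g t1 t2 T hf hg _ IH] x s hp.
  have /= := perm_size hp; case: s hp => // hp _ _.
  by rewrite big_seq1 addn0.
have hp' := hp; rewrite (permPl (perm_map weight hf)) in hp'.
case: s hp hp' => [|y s] _ hp; first by have := perm_size hp.
move=> /= /andP[hs hc].
have [hw hgs] : weight t1 + weight t2 = x + y /\ perm_eq (map weight g) s.
  by apply: perm_two_smallest hp _ hs; rewrite all_map.
rewrite (IH (x + y) s) //=; last by rewrite hw perm_cons.
by rewrite (perm_big _ hf) /= !big_cons ext_path_length_Node; lia.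
Qed.

Section MinimizingSequence.
Variable k : nat.

(** For [j >= 1] this is [p_(j+1)]. *)
Let term j := fib j + fib (j - k.+2).

(** For [i >= 1] this is [p_1 + ... + p_i]. Adding 2 after the truncated subtraction makes the
    second summand [F(2) - 1 = 0] when [i <= k + 3]. *)
Let psum i := fib i.+1 + (fib (i - k.+3).+2 - 1).

Lemma psumS i : psum i + term i = psum i.+1.
Proof.
rewrite /psum /term; have := fib_gt0 (i - k.+3).+1.
case: (leqP k.+3 i) => hi.
  have -> : i.+1 - k.+3 = (i - k.+3).+1 by lia.
  have -> : i - k.+2 = (i - k.+3).+1 by lia.
  by rewrite (fibSS i) (fibSS (i - k.+3).+1); lia.
have -> : i.+1 - k.+3 = 0 by lia.
have -> : i - k.+3 = 0 by lia.
have -> : i - k.+2 = 0 by lia.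
by rewrite (fibSS i) /=; lia.
Qed.

Lemma psum_leq i : psum i <= term i.+1.
Proof.
rewrite /psum /term leq_add2l; case: (leqP k.+3 i) => hi.
  have -> : i.+1 - k.+2 = (i - k.+3).+2 by lia.
  exact: leq_subr.
by have -> : i - k.+3 = 0 by lia.
Qed.

Lemma term_leq : {homo term : i j / i <= j}.
Proof. by move=> i j hij; rewrite leq_add ?fib_leq // leq_sub2r. Qed.

Lemma chain_smallest_terms i m : chain_smallest (psum i) (map term (iota i m)).
Proof.
elim: m i => //= m IH i; rewrite psumS IH andbT all_map.
apply/allP => j; rewrite mem_iota => /andP[hj _] /=.
by rewrite (leq_trans (psum_leq i)) ?term_leq // ltnW.
Qed.

(** The cost telescopes to [G(i + m) - G(i)], where [G(a) = fib a.+3 + fib (a - k.+3).+4 - (a -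
    k.+3)] and [G(i + 1) - G(i) = psum (i + 1)]. Negative terms are moved across to stay in
    [nat]. *)
Lemma chain_cost_terms i m :
  chain_cost (psum i) (map term (iota i m))
    + fib i.+3 + fib (i - k.+3).+4 + (i + m - k.+3)
  = fib (i + m).+3 + fib (i + m - k.+3).+4 + (i - k.+3).
Proof.
elim: m i => [|m IH] i; first by rewrite addn0.
rewrite [chain_cost _ _]/= psumS; have := IH i.+1; rewrite -addSnnS.
rewrite {2}/psum (fibSS i.+2).
have := fib_gt0 (i.+1 - k.+3).+1.
case: (leqP k.+3 i) => hi; last first.
  have -> : i.+1 - k.+3 = 0 by lia.
  have -> : i - k.+3 = 0 by lia.
  by rewrite (erefl : fib 2 = 1); lia.
have -> : i.+1 - k.+3 = (i - k.+3).+1 by lia.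
by rewrite (fibSS (i - k.+3).+3); lia.
Qed.

Lemma pmin_chain (R : realType) n :
  pmin R n.+1 k = psum 1 :: map term (iota 1 n).
Proof.
rewrite /pmin /=; congr (_ :: _).
rewrite -[2]/(1 + 1) iotaDl -map_comp; apply/eq_in_map => -[|j].
  by rewrite mem_iota.
by move=> _ /=; rewrite add1n pmin_termSS.
Qed.

End MinimizingSequence.

Theorem theorem3 (R : realType) (n k : nat) (hn : 3 <= n) (hk : k <= n - 3)
    (T : btree) (hsize : tree_size T = n) (hel : elongated T)
    (hT : huffman_tree (pmin R n k) T) :
  ((ext_path_length T)%:Z
   = (fib (n + 3))%:Z + (fib (n - k + 1))%:Z - (n%:Z - k%:Z + 3%:Z))%R.
Proof.
case: n hn hk {hsize} hT => // n hn hk hT.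
have hw : [seq weight t | t <- map Leaf (pmin R n.+1 k)] = pmin R n.+1 k.
  by rewrite -map_comp map_id.
have := huffman_run_chain hT; rewrite hw pmin_chain => /(_ _ _ (perm_refl _)).
move=> /(_ (chain_smallest_terms k 1 n)).
rewrite big_map big1 => [|p _]; last by rewrite /ext_path_length big_seq1.
have := chain_cost_terms k 1 n; rewrite add0n add1n.
have -> : (n.+1 - k.+3).+4 = n.+1 - k + 1 by lia.
have -> : 1 - k.+3 = 0 by lia.
(* The chain starts at [i = 1], where the telescoped expression is [F(4) + F(4) = 6]; this turns the
   [- 3] of the linear term into [+ 3]. *)
rewrite addn3 (erefl : fib 4 = 3) => h ->; lia.
Qed.
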